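(* Let $H$, $\rho=\rho(t)$ and $A=A(t)$ be operators on a complex Hilbert space, where $t$ is a real time parameter and $H$ does not depend on $t$. Let $\lambda,\mu,\nu$ be nonzero complex numbers with $\lambda\neq\mu$, and let $z_\lambda,z_\mu,z_\nu$ be complex numbers (independent of $t$). Assume that the time-dependent bras $\langle\psi|$, $\langle\chi|$ and the time-dependent ket $|\varphi\rangle$ are solutions of the linear systems (Lax pairs) $$z_\lambda\langle\psi|=\langle\psi|(\rho-\lambda H),\qquad -i\langle\dot\psi|=\tfrac1\lambda\langle\psi|A,$$ $$z_\mu|\varphi\rangle=(\rho-\mu H)|\varphi\rangle,\qquad i|\dot\varphi\rangle=\tfrac1\mu A|\varphi\rangle,$$ $$z_\nu\langle\chi|=\langle\chi|(\rho-\nu H),\qquad -i\langle\dot\chi|=\tfrac1\nu\langle\chi|A,$$ with $\langle\chi|\varphi\rangle\neq0$. Define $$P=\frac{|\varphi\rangle\langle\chi|}{\langle\chi|\varphi\rangle},\qquad \langle\psi_1|=\langle\psi|\Big(\mathbf 1-\frac{\nu-\mu}{\lambda-\mu}P\Big),$$ $$\rho_1=\Big(\mathbf 1+\frac{\mu-\nu}{\nu}P\Big)\rho\Big(\mathbf 1+\frac{\nu-\mu}{\mu}P\Big),\qquad A_1=\Big(\mathbf 1+\frac{\mu-\nu}{\nu}P\Big)A\Big(\mathbf 1+\frac{\nu-\mu}{\mu}P\Big).$$ Then $$z_\lambda\langle\psi_1|=\langle\psi_1|(\rho_1-\lambda H),\qquad -i\langle\dot\psi_1|=\tfrac1\lam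bda\langle\psi_1|A_1.$$
   Context: Dirac notation: a ket $|\varphi\rangle$ is a vector of the Hilbert space, a bra $\langle\psi|$ is the functional associated with an element of the Hilbert space; $\langle\psi|B$ denotes the functional $v\mapsto\langle\psi|(Bv)$ for an operator $B$, and $|\varphi\rangle\langle\chi|$ is the rank-one operator $v\mapsto\langle\chi|v\rangle\,|\varphi\rangle$. A dot denotes the derivative with respect to $t$. $\mathbf 1$ is the identity. The bra $\langle\chi|$ need not be the adjoint of the ket $|\varphi\rangle$. The operators are not assumed bounded; the identities are understood wherever the expressions make sense (domain questions are not addressed in the source). *)

(* Defs.v *)
From HB Require Import structures.
From mathcomp Require Import all_boot all_order all_algebra sesquilinear complex.
From mathcomp Require Import all_classical all_reals all_analysis.

Set Implicit Arguments.
Unset Strict Implicit.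
Unset Printing Implicit Defensive.

Import Order.TTheory GRing.Theory Num.Theory Num.Def.
Import numFieldNormedType.Exports.

Local Open Scope classical_set_scope.
Local Open Scope ring_scope.
Local Open Scope complex_scope.

Record hilbertSpace (R : realType) := HilbertSpace {
  hilbert_sort :> completeNormedModType R[i];
  hilbert_dot : {dot hilbert_sort for conjC};
  hilbert_normE : forall v : hilbert_sort, `|v| ^+ 2 = hilbert_dot v v }.

(* [{dot _ for conjC}] is linear in its first argument and conjugate-linear in
   its second one; [braket u v] is <u|v>, which is linear in [v]. The bra <u|
   is the functional [braket u]. *)
Definition braket (R : realType) (V : hilbertSpace R) (u v : V) : R[i] :=
  hilbert_dot V v u.

(* A not necessarily bounded linear operator. The values of [opfun] outside
   the subspace [dom] carry no meaning. *)
Record operator (R : realType) (V : hilbertSpace R) := Operator {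
  dom : set V;
  opfun :> V -> V;
  dom0 : dom 0;
  domP : forall (a : R[i]) (u v : V), dom u -> dom v -> dom (a *: u + v);
  opfunP : forall (a : R[i]) (u v : V), dom u -> dom v ->
    opfun (a *: u + v) = a *: opfun u + opfun v }.

Section OperatorAlgebra.
Variables (R : realType) (V : hilbertSpace R).

Local Obligation Tactic := try by [].

Program Definition op_one : operator V := @Operator R V setT id _ _ _.

Program Definition op_ketbra (u w : V) : operator V :=
  @Operator R V setT (fun v => braket w v *: u) _ _ _.
Next Obligation.
by move=> u w a x y _ _; rewrite /braket linearPl /= scalerDl scalerA.
Qed.

Program Definition op_scale (a : R[i]) (B : operator V) : operator V :=
  @Operator R V (dom B) (fun v => a *: B v) (dom0 B) (@domP _ _ B) _.
Next Obligation.
by move=> a B b x y Bx By; rewrite /= opfunP // scalerDr !scalerA mulrC.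
Qed.

Program Definition op_add (B D : operator V) : operator V :=
  @Operator R V (dom B `&` dom D) (fun v => B v + D v) _ _ _.
Next Obligation. by move=> B D; split; exact: dom0. Qed.
Next Obligation.
by move=> B D a x y [Bx Dx] [By Dy]; split; exact: domP.
Qed.
Next Obligation.
by move=> B D a x y [Bx Dx] [By Dy]; rewrite /= !opfunP // scalerDr addrACA.
Qed.

Lemma opfun0 (B : operator V) : B 0 = 0.
Proof.
have := opfunP 1 (dom0 B) (dom0 B).
by rewrite !scale1r addr0 => /eqP; rewrite -subr_eq subrr => /eqP.
Qed.

Program Definition op_mul (B D : operator V) : operator V :=
  @Operator R V (dom D `&` [set v | dom B (D v)]) (fun v => B (D v)) _ _ _.
Next Obligation.
by move=> B D; split; [exact: dom0|rewrite /= opfun0; exact: dom0].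
Qed.
Next Obligation.
by move=> B D a x y [Dx /= BDx] [Dy /= BDy]; split;
  [exact: domP|rewrite /= opfunP //; exact: domP].
Qed.
Next Obligation.
by move=> B D a x y [Dx /= BDx] [Dy /= BDy]; rewrite /= !opfunP.
Qed.

End OperatorAlgebra.

Arguments op_one {R V}.

Declare Scope operator_scope.
Delimit Scope operator_scope with Op.
Bind Scope operator_scope with operator.
Arguments op_scale {R V} a%_R B%_Op.
Arguments op_add {R V} B%_Op D%_Op.
Arguments op_mul {R V} B%_Op D%_Op.

Notation "1" := op_one : operator_scope.
Notation "a *: B" := (op_scale a B) : operator_scope.
Notation "B + D" := (op_add B D) : operator_scope.
Notation "B - D" := (op_add B (op_scale (-1) D)) : operator_scope.
Notation "B * D" := (op_mul B D) : operator_scope.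

Section Lax.
Variables (R : realType) (V : hilbertSpace R).

(* The library's [derive] wants the same scalars on both sides, whereas here
   the parameter is real and the space is complex: this is the same difference
   quotient, with its real factor embedded in R[i]. *)
Definition tquotient (f : R -> V) (t h : R) : V :=
  (h^-1)%:C *: (f (h + t) - f t).
Definition tderivable (f : R -> V) (t : R) : Prop :=
  cvg (tquotient f t h @[h --> 0^']).
Definition tderive (f : R -> V) (t : R) : V :=
  lim (tquotient f t h @[h --> 0^']).

(* z <psi| = <psi|(rho - lambda H)  and  -i <psi'| = (1/lambda) <psi|A.
   For an operator B, <psi|B is the functional v |-> <psi|(B v), defined on
   [dom B], and each equation is read on the domain of its right-hand side. *)
Definition bra_lax (H : operator V) (rho A : R -> operator V) (lambda z : R[i])
    (psi : R -> V) : Prop :=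
  forall t,
  [/\ forall v, dom (rho t - lambda *: H)%Op v ->
        z * braket (psi t) v = braket (psi t) ((rho t - lambda *: H)%Op v),
      tderivable psi t &
      forall v, dom (A t) v ->
        - 'i%C * braket (tderive psi t) v = lambda^-1 * braket (psi t) (A t v)].

(* z |phi> = (rho - mu H)|phi>  and  i |phi'> = (1/mu) A |phi>. *)
Definition ket_lax (H : operator V) (rho A : R -> operator V) (mu z : R[i])
    (phi : R -> V) : Prop :=
  forall t,
  [/\ dom (rho t - mu *: H)%Op (phi t),
      z *: phi t = (rho t - mu *: H)%Op (phi t),
      tderivable phi t,
      dom (A t) (phi t) &
      'i%C *: tderive phi t = mu^-1 *: A t (phi t)].

End Lax.

(* Main.v *)
Require Import Defs.
From mathcomp Require Import all_boot all_order all_algebra sesquilinear complex ring.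
From mathcomp Require Import all_classical all_reals all_analysis.

(* The bra <psi_1| is <psi| - kappa (<psi|phi>/<chi|phi>) <chi| with
   kappa = (nu - mu)/(lambda - mu). Evaluated at a vector v, each of the two new
   equations is a rational identity between the finitely many numbers <psi|B w>
   and <chi|B w> with B = 1, rho, H, A and w = v, phi, subject to the old
   equations at v and phi. For the evolution equation one needs d/dt <psi|phi>
   and d/dt <chi|phi>, hence the product rule for the inner product, which is
   continuous by Cauchy-Schwarz. As phi lies in the domains of rho and A, so does
   v whenever it lies in the domain of the transformed operator. *)

Set Implicit Arguments.
Unset Strict Implicit.

Import Order.TTheory GRing.Theory Num.Theory Num.Def.
Import numFieldNormedType.Exports.

Local Open Scope classical_set_scope.
Local Open Scope ring_scope.

(** * Cauchy-Schwarz and a squeeze principle over a partially ordered field *)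

Lemma dot_CauchySchwarz (C : numClosedFieldType) (U : lmodType C)
    (form : {dot U for conjC}) (u v : U) :
  `|form u v| ^+ 2 <= form u u * form v v.
Proof.
have [->|v0] := eqVneq v 0.
  by rewrite linear0r normr0 expr0n linear0r mulr0.
have vv0 : 0 < form v v by rewrite dnorm_gt0.
have vv_conj : (form v v)^* = form v v by apply/CrealP; rewrite gtr0_real.
(* The subtracted vector is the orthogonal projection of [u] on [v]. Expanded, nonnegativity of the
   square norm of the remainder is the claim divided by [form v v]. *)
have := dnorm_ge0 form (u - (form u v / form v v) *: v).
rewrite dnormB dnormZ linearZr_LR /=.
rewrite !rmorphM /= fmorphV /= vv_conj conjCK fmorphV /= vv_conj.
rewrite normrM normfV (gtr0_norm vv0).
have -> : (form u v)^* / form v v * form u v = `|form u v| ^+ 2 / form v v.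
  rewrite normCK; ring.
have -> : form u v / form v v * (form u v)^* = `|form u v| ^+ 2 / form v v.
  rewrite normCK; ring.
have -> : form u u + (`|form u v| / form v v) ^+ 2 * form v v -
  (`|form u v| ^+ 2 / form v v + `|form u v| ^+ 2 / form v v) =
  form u u - `|form u v| ^+ 2 / form v v by field; rewrite gt_eqF.
by rewrite subr_ge0 ler_pdivrMr.
Qed.

Lemma cvg0_norm_le (K : numFieldType) (W : normedModType K) (T : Type)
    (F : set_system T) {FF : Filter F} (f : T -> W) (b : T -> K) :
  (forall x, `|f x| <= b x) -> b x @[x --> F] --> (0 : K) ->
  f x @[x --> F] --> (0 : W).
Proof.
move=> fb b0; apply/cvgr0Pnorm_lt => e e0.
have [+ _] := @cvgr0Pnorm_lt K K^o T F _ b.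
move=> /(_ b0 e e0); apply: filterS => x; apply: le_lt_trans.
(* The order of [K] may be partial, so [b x] is compared with its modulus only once known to be
   real, which follows from its lying above a norm. *)
by rewrite (le_trans (fb x))// real_ler_norm// ger0_real// (le_trans _ (fb x)).
Qed.

(** * Derivatives in a real parameter over complex scalars *)

Section DotCalculus.
Variables (K : numClosedFieldType) (U : normedModType K).
Variable (form : {dot U for conjC}).
Hypothesis normE : forall v : U, `|v| ^+ 2 = form v v.

Lemma dot_norm_le (u v : U) : `|form u v| <= `|u| * `|v|.
Proof.
rewrite -(@ler_pXn2r _ 2) ?nnegrE ?mulr_ge0 ?normr_ge0 //.
by rewrite exprMn !normE; exact: dot_CauchySchwarz.
Qed.

Lemma cvg_dot (T : Type) (F : set_system T) {FF : Filter F}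
    (f g : T -> U) (u v : U) :
  f x @[x --> F] --> u -> g x @[x --> F] --> v ->
  form (f x) (g x) @[x --> F] --> form u v.
Proof.
move=> fu gv; apply/(@subr_cvg0 K K^o).
apply: (@cvg0_norm_le K K^o T F _ _
  (fun x => `|f x - u| * `|g x| + `|u| * `|g x - v|)).
  move=> x; have -> : form (f x) (g x) - form u v =
      form (f x - u) (g x) + form u (g x - v).
    by rewrite linearBl linearBr /= addrA subrK.
  by rewrite (le_trans (ler_normD _ _))// lerD// dot_norm_le.
have -> : (0 : K) = `|0 : U| * `|v| + `|u| * `|0 : U|.
  by rewrite normr0 mul0r mulr0 addr0.
have fu0 : f x - u @[x --> F] --> (0 : U) by exact/subr_cvg0.
have gv0 : g x - v @[x --> F] --> (0 : U) by exact/subr_cvg0.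
by apply: (@cvgD K K^o); apply: cvgM; do ?[exact: cvg_norm|exact: cvg_cst].
Qed.

Variables (R : realType) (iota : {rmorphism R -> K}).
Hypothesis iota_real : forall x, (iota x)^* = iota x.
Hypothesis iota_cvg0 : iota h @[h --> 0^'] --> (0 : K).

(** Here [iota] stands for the embedding of the reals into the complex numbers. The codomain is an
    arbitrary normed space, so that scalars, viewed in [K^o], and vectors share the same rules. *)
Definition has_rderive {W : normedModType K} (f : R -> W) (t : R) (l : W) :=
  iota h^-1 *: (f (h + t) - f t) @[h --> 0^'] --> l.

Lemma has_rderive_cvg (W : normedModType K) (f : R -> W) (t : R) (l : W) :
  has_rderive f t l -> f (h + t) @[h --> 0^'] --> f t.
Proof.
move=> fl; apply/subr_cvg0.
rewrite -[X in _ --> X](scale0r l).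
apply: cvg_trans (cvgZ iota_cvg0 fl).
apply: near_eq_cvg; near=> h.
rewrite scalerA -rmorphM /= divff ?rmorph1 ?scale1r//.
by near: h; exact: nbhs_dnbhs_neq.
Unshelve. all: by end_near. Qed.

Lemma has_rderiveB (W : normedModType K) (f g : R -> W) (t : R) (l m : W) :
  has_rderive f t l -> has_rderive g t m ->
  has_rderive (fun s => f s - g s) t (l - m).
Proof.
move=> fl gm; apply: cvg_trans (cvgB fl gm).
apply: near_eq_cvg; apply: nearW => h; rewrite !fctE -scalerBr; congr (_ *: _).
by rewrite !opprD !opprK addrACA.
Qed.

Lemma has_rderiveZr (W : normedModType K) (a : K) (g : R -> W) (t : R)
    (m : W) :
  has_rderive g t m -> has_rderive (fun s => a *: g s) t (a *: m).
Proof.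
move=> gm; apply: cvg_trans; last exact: (cvgZ (cvg_cst a) gm).
apply: near_eq_cvg; apply: nearW => h /=.
by rewrite -scalerBr !scalerA mulrC.
Qed.

Lemma has_rderiveZ (W : normedModType K) (f : R -> K) (g : R -> W) (t : R)
    (l : K) (m : W) :
  has_rderive (f : R -> K^o) t l -> has_rderive g t m ->
  has_rderive (fun s => f s *: g s) t (l *: g t + f t *: m).
Proof.
move=> fl gm.
apply: cvg_trans; last first.
  exact: (cvgD (cvgZ fl (has_rderive_cvg gm)) (cvgZ (cvg_cst (f t)) gm)).
apply: near_eq_cvg; apply: nearW => h; rewrite /= !fctE /=.
rewrite -[X in X *: g (h + t)]/(iota h^-1 * _) [f t *: (_ *: _)]scalerA.
rewrite [f t * _]mulrC -!scalerA.
by rewrite -scalerDr scalerBl scalerBr addrA subrK.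
Qed.

(** The form is conjugate-linear in its second slot, but [iota h^-1] is its own conjugate and so
    leaves either slot unchanged. The usual splitting of the increment then applies. *)
Lemma has_rderive_dot (f g : R -> U) (t : R) (l m : U) :
  has_rderive f t l -> has_rderive g t m ->
  has_rderive (fun s => form (f s) (g s) : K^o) t
    (form l (g t) + form (f t) m).
Proof.
move=> fl gm.
have fc : f t @[_ --> (0 : R)^'] --> f t by exact: cvg_cst.
have lg : form (iota h^-1 *: (f (h + t) - f t)) (g (h + t)) @[h --> 0^'] -->
    form l (g t) by apply: cvg_dot => //; exact: has_rderive_cvg gm.
have fm : form (f t) (iota h^-1 *: (g (h + t) - g t)) @[h --> 0^'] -->
    form (f t) m by exact: cvg_dot.
apply: cvg_trans; last exact: (@cvgD K K^o _ _ _ _ _ _ _ lg fm).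
apply: near_eq_cvg; apply: nearW => h; rewrite !fctE /=.
rewrite linearZl_LR linearZr_LR linearBl linearBr /= iota_real.
rewrite (linearBr form (f t)) /= -[RHS]/(iota h^-1 * _) !mulrBr.
by rewrite addrA subrK.
Qed.

Lemma has_rderive_div (f g : R -> K) (t : R) (l m : K) :
  (forall s, g s != 0) ->
  has_rderive (f : R -> K^o) t l -> has_rderive (g : R -> K^o) t m ->
  has_rderive (fun s => f s / g s : K^o) t ((l * g t - f t * m) / g t ^+ 2).
Proof.
move=> g0 fl gm.
have gc := has_rderive_cvg gm.
have gg : (g (h + t) * g t)^-1 @[h --> 0^'] --> (g t * g t)^-1.
  by apply: cvgV; [rewrite mulf_neq0|apply: cvgM gc (cvg_cst _)].
rewrite expr2; apply: cvg_trans; last first.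
  exact: (cvgM (@cvgB K K^o _ _ _ _ _ _ _ (cvgM fl (cvg_cst (g t)))
    (cvgM (cvg_cst (f t)) gm)) gg).
apply: near_eq_cvg; apply: nearW => h; rewrite !fctE /= /GRing.scale /=.
(* With [iota h^-1] generalised to [r], the identity holds for every [h], and only the values of [g]
   have to be nonzero. *)
by move: (iota _) => r; field; rewrite !g0.
Qed.

End DotCalculus.

(** * Brackets, time derivatives and operator domains in the Hilbert space *)

Section HilbertCalculus.
Variables (R : realType) (V : hilbertSpace R).

Lemma braketC (u v : V) : (braket u v)^* = braket v u.
Proof. by rewrite /braket [in RHS]hermC /= expr0 mul1r. Qed.

Lemma braketDr (u v w : V) : braket u (v + w) = braket u v + braket u w.
Proof. exact: linearDl. Qed.

Lemma braketZr a (u v : V) : braket u (a *: v) = a * braket u v.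
Proof. exact: linearZl_LR. Qed.

Lemma braketDl (u v w : V) : braket (v + w) u = braket v u + braket w u.
Proof. exact: linearDr. Qed.

Lemma braketBl (u v w : V) : braket (v - w) u = braket v u - braket w u.
Proof. exact: linearBr. Qed.

Lemma braketZl a (u v : V) : braket (a *: u) v = a^* * braket u v.
Proof. exact: linearZr_LR. Qed.

Lemma conj_real_complex (x : R) : (x%:C)%C^*%R = (x%:C)%C.
Proof. exact: conjc_real. Qed.

Lemma cvg_real_complex0 :
  real_complex R h @[h --> (0 : R)^'] --> (0 : (R[i] : numFieldType)).
Proof.
have [_] := @cvgr0Pnorm_lt R[i] (R[i] : numFieldType)^o R 0^' _ (real_complex R).
(* In the order of [R[i]], [0 < e] forces [e] to be real, which reduces the goal to a real bound on
   [|h|]. *)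
apply => e; rewrite ltcE /= => /andP[/eqP e_real e0]; near=> h.
rewrite normc_def /= expr0n addr0 sqrtr_sqr ltcE /= e_real eqxx /=.
by near: h; exact: dnbhs0_lt.
Unshelve. all: by end_near. Qed.

(** Carries the Lax equations, phrased with [tderive], into the calculus of [has_rderive] and back;
    limits are unique because the space is Hausdorff. *)
Lemma has_tderiveP (f : R -> V) (t : R) (l : V) :
  has_rderive (real_complex R) f t l <-> tderivable f t /\ tderive f t = l.
Proof.
split=> [fl|[fd <-]]; last exact: fd.
split; first by apply/cvg_ex; exists l.
by apply: cvg_lim => //; exact: norm_hausdorff.
Qed.

(** The domain is a subspace and [v] is [(v + a *: u) - a *: u]. With [u] equal to [phi], this
    recovers the domain of [B] from that of the transformed operator. *)
Lemma dom_add_scale (B : operator V) (a : R[i]) (u v : V) :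
  dom B u -> dom B (v + a *: u) -> dom B v.
Proof.
move=> Bu Bvu; have := domP (- a) Bu Bvu.
by rewrite addrCA scaleNr addNr addr0.
Qed.

Lemma opfun_add_scale (B : operator V) (a : R[i]) (u v : V) :
  dom B u -> dom B v -> B (v + a *: u) = B v + a *: B u.
Proof. by move=> Bu Bv; rewrite addrC opfunP // addrC. Qed.

End HilbertCalculus.

(* In the two identities below, [n] is <chi|phi>. The names of the other
   scalars are read as follows: [a], [b], [c] are <psi|v>, <psi|phi>, <chi|v>;
   [pr], [ph], [pA] and [cr], [ch], [cA] are <psi|B v> and <chi|B v> for
   B = rho, H, A; a final [f] replaces [v] by [phi]. The prefix [d] in [dp],
   [dc] differentiates the bra, and [pdf], [cdf] are <psi|phi'>, <chi|phi'>. *)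
Section DarbouxIdentities.
Variable F : fieldType.
Variables (lambda mu nu z_l z_m z_n : F) (a b c n : F).
Hypotheses (l0 : lambda != 0) (m0 : mu != 0) (nu0 : nu != 0).
Hypotheses (lm : lambda != mu) (n0 : n != 0).

Local Notation kappa := ((nu - mu) / (lambda - mu)).
Local Notation alpha := ((mu - nu) / nu).
Local Notation beta := ((nu - mu) / mu).

Lemma darboux_spectral (pr ph cr ch prf phf crf chf : F) :
  z_l * a = pr - lambda * ph -> z_l * b = prf - lambda * phf ->
  z_m * b = prf - mu * phf ->
  z_n * c = cr - nu * ch -> z_n * n = crf - nu * chf ->
  z_m * n = crf - mu * chf ->
  z_l * (a - kappa * (b / n * c)) =
  (pr + beta * (c / n) * prf) + alpha * ((cr + beta * (c / n) * crf) / n) * b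
  - kappa * (b / n * ((cr + beta * (c / n) * crf)
     + alpha * ((cr + beta * (c / n) * crf) / n) * n))
  - lambda * (ph - kappa * (b / n * ch)).
Proof.
have lm' : lambda - mu != 0 by rewrite subr_eq0.
move=> /eqP; rewrite eq_sym subr_eq => /eqP ->.
move=> /eqP; rewrite eq_sym subr_eq => /eqP ->.
move=> e1.
(* Both equations for [phi], paired with <psi|, determine <psi|H phi>. *)
have -> : phf = (z_m - z_l) * b / (lambda - mu).
  by apply: (mulIf lm'); rewrite divfK // mulrBl e1; ring.
move=> /eqP; rewrite eq_sym subr_eq => /eqP ->.
move=> /eqP; rewrite eq_sym subr_eq => /eqP ->.
(* Pairing with <chi| gives [(z_m - z_n) * n = (nu - mu) * chf]. Since [nu = mu] is allowed, this is
   solved for [z_m] and not for [chf]. *)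
move=> e2; have -> : z_m = z_n + (nu - mu) * chf / n.
  by apply: (mulIf n0); rewrite e2; field.
by field; rewrite n0 lm' m0 nu0.
Qed.

Lemma darboux_evolution (j dp dpf pdf dc dcf cdf pA pAf cA cAf : F) :
  - j * dp = lambda^-1 * pA -> - j * dpf = lambda^-1 * pAf ->
  j * pdf = mu^-1 * pAf ->
  - j * dc = nu^-1 * cA -> - j * dcf = nu^-1 * cAf ->
  j * cdf = mu^-1 * cAf ->
  - j * (dp - (((dpf + pdf) * n - b * (dcf + cdf)) / n ^+ 2 * (kappa * c)
     + b / n * (kappa * dc))) =
  lambda^-1 * ((pA + beta * (c / n) * pAf)
     + alpha * ((cA + beta * (c / n) * cAf) / n) * b
  - kappa * (b / n * ((cA + beta * (c / n) * cAf)
     + alpha * ((cA + beta * (c / n) * cAf) / n) * n))).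
Proof.
have lm' : lambda - mu != 0 by rewrite subr_eq0.
move=> e1 e2 e3 e4 e5 e6.
(* The derivative is linear in the six derivative values, so [- j] can be moved onto each of them,
   where the evolution equations apply. *)
have -> : - j * (dp - (((dpf + pdf) * n - b * (dcf + cdf)) / n ^+ 2 * (kappa * c)
     + b / n * (kappa * dc))) =
  - j * dp - (((- j * dpf - j * pdf) * n - b * (- j * dcf - j * cdf)) / n ^+ 2
     * (kappa * c) + b / n * (kappa * (- j * dc))) by ring.
rewrite e1 e2 e3 e4 e5 e6.
by field; rewrite n0 lm' m0 nu0 l0.
Qed.

End DarbouxIdentities.

Unset Implicit Arguments.
Set Strict Implicit.

Local Open Scope complex_scope.

Theorem mainTheorem1 (R : realType) (V : hilbertSpace R)
  (H : operator V) (rho A : R -> operator V)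
  (lambda mu nu z_lambda z_mu z_nu : R[i])
  (lambda_neq0 : lambda != 0) (mu_neq0 : mu != 0) (nu_neq0 : nu != 0)
  (lambda_neq_mu : lambda != mu)
  (psi chi phi : R -> V)
  (psi_lax : bra_lax H rho A lambda z_lambda psi)
  (phi_lax : ket_lax H rho A mu z_mu phi)
  (chi_lax : bra_lax H rho A nu z_nu chi)
  (chi_phi_neq0 : forall t : R, braket (chi t) (phi t) != 0) :
  let P (t : R) : operator V :=
    ((braket (chi t) (phi t))^-1 *: op_ketbra (phi t) (chi t))%Op in
  let rho1 (t : R) : operator V :=
    ((1 + ((mu - nu) / nu) *: P t) * rho t * (1 + ((nu - mu) / mu) *: P t))%Op in
  let A1 (t : R) : operator V :=
    ((1 + ((mu - nu) / nu) *: P t) * A t * (1 + ((nu - mu) / mu) *: P t))%Op in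
  exists psi1 : R -> V,
    (forall (t : R) (v : V), braket (psi1 t) v =
       braket (psi t) ((1 - ((nu - mu) / (lambda - mu)) *: P t)%Op v)) /\
    bra_lax H rho1 A1 lambda z_lambda psi1.
Proof.
move=> P rho1 A1.
pose kappa := (nu - mu) / (lambda - mu).
(* The bra <psi|(1 - kappa P) is represented by the vector [psi1], whose
   coefficients are conjugated because [braket] is antilinear on the left. *)
pose coef t := braket (phi t) (psi t) / braket (phi t) (chi t).
pose psi1 t := psi t - coef t *: (kappa^*%R *: chi t).
have phi_chi_neq0 t : braket (phi t) (chi t) != 0.
  by rewrite -braketC fmorph_eq0.
have coefC t : (coef t)^*%R = braket (psi t) (phi t) / braket (chi t) (phi t).
  by rewrite rmorphM /= fmorphV /= !braketC.
have psi1E t v : braket (psi1 t) v = braket (psi t) v -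
    kappa * (braket (psi t) (phi t) / braket (chi t) (phi t) * braket (chi t) v).
  by rewrite braketBl !braketZl coefC conjCK mulrCA.
have PE s t x : (1 + s *: P t)%Op x =
    x + (s * (braket (chi t) x / braket (chi t) (phi t))) *: phi t.
  by rewrite /= !scalerA -mulrA [_^-1 * _]mulrC.
(* Used for both [rho] and [A]. The vector [w] is [B] applied to [v + a *: phi t], the image of [v]
   under the right factor; the left factor then adds a multiple of [phi t]. *)
have dressE (B : operator V) t v (a := (nu - mu) / mu *
      (braket (chi t) v / braket (chi t) (phi t)))
    (w := B v + a *: B (phi t)) :
    dom B (phi t) -> dom ((1 + ((mu - nu) / nu) *: P t) * B *
                      (1 + ((nu - mu) / mu) *: P t))%Op v ->
  dom B v /\
  ((1 + ((mu - nu) / nu) *: P t) * B * (1 + ((nu - mu) / mu) *: P t))%Op v =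
  w + ((mu - nu) / nu * (braket (chi t) w / braket (chi t) (phi t))) *: phi t.
  move=> Bphi [_ [+ _]].
  rewrite [X in dom B X -> _]PE => /(dom_add_scale Bphi) Bv; split=> //.
  rewrite -[LHS]/((1 + ((mu - nu) / nu) *: P t)%Op
    (B ((1 + ((nu - mu) / mu) *: P t)%Op v))).
  by rewrite !PE opfun_add_scale.
have psi1_dress t (x y : V) r s :
  braket (psi1 t) (x + r *: y + s *: phi t) =
  braket (psi t) x + r * braket (psi t) y + s * braket (psi t) (phi t)
  - kappa * (braket (psi t) (phi t) / braket (chi t) (phi t) *
     ((braket (chi t) x + r * braket (chi t) y) + s * braket (chi t) (phi t))).
  by rewrite psi1E !braketDr !braketZr.
exists psi1; split.
  move=> t v; rewrite psi1E /= !braketDr !braketZr -/kappa mulN1r.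
  by rewrite [_^-1 * _]mulrCA [_^-1 * _]mulrC [braket _ v * _]mulrC.
move=> t.
have [psi_s psi_d psi_e] := psi_lax t.
have [chi_s chi_d chi_e] := chi_lax t.
have [[phi_rho phi_H] phi_s phi_d phi_A phi_e] := phi_lax t.
(* The representing vector is differentiated, [coef] by the quotient rule; hence the brackets have
   [phi] on the left until conjugation. *)
have psi1_d : has_rderive (real_complex R) psi1 t
    (tderive psi t -
      (((braket (phi t) (tderive psi t) + braket (tderive phi t) (psi t)) *
          braket (phi t) (chi t) -
        braket (phi t) (psi t) *
          (braket (phi t) (tderive chi t) + braket (tderive phi t) (chi t))) /
         braket (phi t) (chi t) ^+ 2 *: (kappa^*%R *: chi t) +
       coef t *: (kappa^*%R *: tderive chi t))).
  have dpsi := (has_tderiveP psi t _).2 (conj psi_d erefl).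
  have dchi := (has_tderiveP chi t _).2 (conj chi_d erefl).
  have dphi := (has_tderiveP phi t _).2 (conj phi_d erefl).
  have dnum : has_rderive (real_complex R)
    (fun s => braket (phi s) (psi s) : (R[i] : numFieldType)^o) t _ :=
    has_rderive_dot (@hilbert_normE R V) (@conj_real_complex R)
      (@cvg_real_complex0 R) dpsi dphi.
  have dden : has_rderive (real_complex R)
    (fun s => braket (phi s) (chi s) : (R[i] : numFieldType)^o) t _ :=
    has_rderive_dot (@hilbert_normE R V) (@conj_real_complex R)
      (@cvg_real_complex0 R) dchi dphi.
  have dcoef := has_rderive_div (@cvg_real_complex0 R) phi_chi_neq0 dnum dden.
  have dkchi := has_rderiveZr (a := kappa^*%R) dchi.
  exact: has_rderiveB dpsi (has_rderiveZ (@cvg_real_complex0 R) dcoef dkchi).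
have [psi1_td psi1_e] := (has_tderiveP _ _ _).1 psi1_d.
split=> //.
- move=> v [v_rho1 v_H].
  have [v_rho rho1E] := dressE (rho t) t v phi_rho v_rho1.
  rewrite -[(rho1 t - _)%Op v]/(rho1 t v + -1 *: (lambda *: H v)) rho1E.
  rewrite braketDr psi1_dress !braketZr !psi1E mulN1r !braketDr !braketZr.
  (* The six premises are the equations of <psi| at [v] and [phi], that of [phi] paired with <psi|,
     and the same three with <chi|. *)
  apply: (darboux_spectral (z_m := z_mu) (z_n := z_nu)) => //.
  + rewrite psi_s; last by split.
    by rewrite /= braketDr !braketZr mulN1r.
  + rewrite psi_s; last by split.
    by rewrite /= braketDr !braketZr mulN1r.
  + by rewrite -[LHS]braketZr phi_s /= braketDr !braketZr mulN1r.
  + rewrite chi_s; last by split.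
    by rewrite /= braketDr !braketZr mulN1r.
  + rewrite chi_s; last by split.
    by rewrite /= braketDr !braketZr mulN1r.
  + by rewrite -[LHS]braketZr phi_s /= braketDr !braketZr mulN1r.
- move=> v v_A1; have [v_A A1E] := dressE (A t) t v phi_A v_A1.
  rewrite A1E psi1_dress psi1_e.
  rewrite braketBl braketDl !braketZl !braketDr !braketZr coefC conjCK.
  (* Conjugating the derivative of [coef] moves [phi] to the right of every bracket, giving the form
     of [darboux_evolution]. *)
  rewrite !(rmorphM, rmorphB, rmorphD, fmorphV, rmorphXn) /= !braketC -expr2.
  have phi_e' u :
      'i%C * braket u (tderive phi t) = mu^-1 * braket u (A t (phi t)).
    by rewrite -[LHS]braketZr phi_e braketZr.
  exact: (darboux_evolution (braket (psi t) (phi t)) (braket (chi t) v)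
    lambda_neq0 mu_neq0 nu_neq0 lambda_neq_mu
    (chi_phi_neq0 t) (psi_e v v_A) (psi_e _ phi_A) (phi_e' (psi t))
    (chi_e v v_A) (chi_e _ phi_A) (phi_e' (chi t))).
Qed.
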